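(* Let $N\geq 1$ and $K\geq 0$ be natural numbers. Then, for an arbitrary variable $x$, $$\Big(\sum_{0\leq j<N} x^{j}\Big)^{K} \;=\; \sum_{0\leq i\leq (N-1)\cdot K} C_{N}(K,i)\cdot x^{i}.$$
   Context: For $N\geq 1$ write $\boldsymbol{N}=\{0,1,\ldots,N-1\}\subseteq\mathbb{N}$. For $K\in\mathbb{N}$ and $0\leq i\leq (N-1)\cdot K$, the $N$-nomial coefficient is the natural number $$C_{N}(K,i) := \big|\{(n_1,\ldots,n_K)\in\boldsymbol{N}^{K} \mid n_1+\cdots+n_K = i\}\big|.$$ *)

(* Defs.v *)
From mathcomp Require Import all_boot all_order all_algebra.

Set Implicit Arguments.
Unset Strict Implicit.
Unset Printing Implicit Defensive.

(* The N-nomial coefficient C_N(K, i). For i > (N - 1) * K the set is empty,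
   so the value is 0. *)
Definition Nnomial (N K i : nat) : nat :=
  #|[set n : K.-tuple 'I_N | \sum_(k < K) tnth n k == i]|.

(* Main.v *)
Require Import Defs.
From mathcomp Require Import all_boot all_order all_algebra.

Import GRing.Theory.

Local Open Scope ring_scope.

(** Distributivity ([expr_sum_tuple]) expands the power into one monomial per tuple of exponents,
    namely [x] to the sum of the entries. Grouping tuples by that sum, which [sum_tuple_ord_leq]
    bounds, gives fibres whose sizes are the N-nomial coefficients. *)

Lemma expr_sum_tuple (R : pzSemiRingType) (J : finType) (K : nat) (F : J -> R) :
  (\sum_j F j) ^+ K = \sum_(t : K.-tuple J) \prod_(k < K) F (tnth t k).
Proof.
rewrite -[LHS](_ : \prod_(k < K) \sum_j F j = _); last by rewrite prodr_const card_ord.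
rewrite bigA_distr_bigA (reindex (fun t : K.-tuple J => [ffun k => tnth t k])) /=.
  by apply: eq_bigr => t _; apply: eq_bigr => k _; rewrite ffunE.
exists (fun f : {ffun 'I_K -> J} => [tuple f k | k < K]) => [t _ | f _].
  by apply: eq_from_tnth => k; rewrite tnth_mktuple ffunE.
by apply/ffunP => k; rewrite ffunE tnth_mktuple.
Qed.

Lemma sum_tuple_ord_leq (N K : nat) (t : K.-tuple 'I_N) :
  (\sum_(k < K) tnth t k <= (N - 1) * K)%N.
Proof.
rewrite mulnC -[X in (X * _)%N]card_ord -sum_nat_const.
(* The side condition [0 < N] comes from the entry [tnth t k] itself, which lies in ['I_N]. *)
by apply: leq_sum => k _; rewrite leq_subRL ?ltn_ord // (leq_ltn_trans _ (ltn_ord (tnth t k))).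
Qed.

Theorem theorem1 (R : pzSemiRingType) (N K : nat) (hN : (1 <= N)%N) (x : R) :
  (\sum_(0 <= j < N) x ^+ j) ^+ K =
  \sum_(0 <= i < ((N - 1) * K).+1) (Nnomial N K i)%:R * x ^+ i.
Proof.
rewrite !big_mkord expr_sum_tuple.
(* The sum of entries is cast to an ordinal so that it can index the fibres; by [sum_tuple_ord_leq],
   [inord] never falls back to its default value here. *)
rewrite (partition_big
  (fun t : K.-tuple 'I_N => inord (\sum_(k < K) tnth t k) : 'I_((N - 1) * K).+1)
  predT) //=.
(* The coefficient is unfolded into a constant sum of [x ^+ i] over the tuples it counts, to be
   matched term by term with the fibre over [i]. *)
apply: eq_bigr => i _; rewrite mulr_natl /Nnomial -sumr_const.
apply: eq_big => [t | t /eqP <-].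
  by rewrite inE -val_eqE /= inordK // ltnS sum_tuple_ord_leq.
by rewrite inordK ?ltnS ?sum_tuple_ord_leq // prodrXr.
Qed.
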